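(* For the $k$-server problem and any $\varepsilon>0$, the bijective ratio of $\textsc{greedy}$ (against the optimal offline algorithm) is at least $\frac{k}{2}-\varepsilon$ on the line and at least $\frac{k}{3}-\varepsilon$ on the circle.
   Context: The line $[0,1]$ (resp. the circle of circumference 1) is modelled by a path (resp. cycle) with equally spaced vertices at spacing $\delta>0$, which may be arbitrarily small. $k$ servers occupy vertices; a request is a vertex to which an algorithm must move a server; cost is total distance moved; all algorithms start from the same initial configuration. $\mathcal{I}_n$ is the set of request sequences of length $n$, $A(\sigma)$ the cost of $A$ on $\sigma$. $\textsc{greedy}$ serves each request by moving the closest server. The bijective ratio of an online algorithm $A$ against algorithm $B$ is at most $\rho$ if there is $n_0$ such that for all $n\ge n_0$ there is a bijection $\pi:\mathcal{I}_n\to\mathcal{I}_n$ with $A(\sigma)\le\rho\cdot B(\pi(\sigma))$ for all $\sigma\in\mathcal{I}_n$ (asymptotic version: $A(\sigma)\le\rho\cdot B(\pi(\sigma))+c$ for a constant $c$ independent of $n$); the bijective ratio is the infimum of such $\rho$. *)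

(* Defs.v *)
From HB Require Import structures.
From mathcomp Require Import all_boot all_order all_algebra.
From mathcomp Require Import all_classical all_reals all_analysis.
Set Implicit Arguments.
Unset Strict Implicit.
Unset Printing Implicit Defensive.
Import Order.TTheory GRing.Theory Num.Theory.
Local Open Scope classical_set_scope.
Local Open Scope ring_scope.

(* [0, 1] as a path on the vertices 0, 1/m, ..., m/m (spacing delta = 1/m). *)
Definition line_dist (R : realType) (m : nat) (x y : 'I_m.+1) : R :=
  `|(x : nat)%:R - (y : nat)%:R| / m%:R.

(* The circle of circumference 1 as a cycle on m vertices (spacing 1/m). *)
Definition circle_dist (R : realType) (m : nat) (x y : 'I_m) : R :=
  Num.min `|(x : nat)%:R - (y : nat)%:R|
          (m%:R - `|(x : nat)%:R - (y : nat)%:R|) / m%:R.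

Section KServer.
Variables (R : realType) (V : finType) (d : V -> V -> R) (k : nat).

(* Servers are labelled; several servers may share a vertex. *)
Definition config := {ffun 'I_k -> V}.

Definition occupied (r : V) (C : config) : bool := [exists i, C i == r].

Definition move_cost (C C' : config) : R := \sum_(i < k) d (C i) (C' i).

Fixpoint schedule_cost (C : config) (cs : seq config) : R :=
  if cs is C' :: cs' then move_cost C C' + schedule_cost C' cs' else 0.

(* cs lists the configurations reached after each request of s in turn;
   all2 forces size cs = size s. *)
Definition serves (s : seq V) (cs : seq config) : bool := all2 occupied s cs.

Definition opt (C0 : config) (s : seq V) : R :=
  inf [set schedule_cost C0 cs | cs in [set cs | serves s cs]].

(* An online algorithm: the configuration as a function of the requests
   revealed so far; A [::] is the initial configuration. *)
Definition online := seq V -> config.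

Definition online_cost (A : online) (s : seq V) : R :=
  schedule_cost (A [::]) [seq A (take t.+1 s) | t <- iota 0 (size s)].

Definition closest (C : config) (r : V) (i : 'I_k) : Prop :=
  forall j, d (C i) r <= d (C j) r.

Definition move_server (C : config) (i : 'I_k) (r : V) : config :=
  [ffun j => if j == i then r else C j].

(* Ties are broken arbitrarily, possibly depending on the history. *)
Definition greedy (C0 : config) (A : online) : Prop :=
  A [::] = C0 /\
  forall s r, exists i, closest (A s) r i /\
                        A (rcons s r) = move_server (A s) i r.

End KServer.

Section BijectiveRatio.
Variables (R : realType) (V : finType) (a b : seq V -> R).

Definition bij_ratio_le (rho : R) : Prop :=
  exists n0 : nat, forall n, (n0 <= n)%N ->
  exists pi : n.-tuple V -> n.-tuple V,
    bijective pi /\ forall s : n.-tuple V, a s <= rho * b (pi s).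

Definition bij_ratio : \bar R :=
  ereal_inf [set rho%:E | rho in [set rho | bij_ratio_le rho]].

Definition asym_bij_ratio_le (rho : R) : Prop :=
  exists (c : R) (n0 : nat), forall n, (n0 <= n)%N ->
  exists pi : n.-tuple V -> n.-tuple V,
    bijective pi /\ forall s : n.-tuple V, a s <= rho * b (pi s) + c.

Definition asym_bij_ratio : \bar R :=
  ereal_inf [set rho%:E | rho in [set rho | asym_bij_ratio_le rho]].

End BijectiveRatio.

(* Main.v *)
Require Import Defs.
From HB Require Import structures.
From mathcomp Require Import all_boot all_order all_algebra.
From mathcomp Require Import all_classical all_reals all_analysis.
From mathcomp Require Import zify lra.
Set Implicit Arguments.
Unset Strict Implicit.
Unset Printing Implicit Defensive.
Import Order.TTheory GRing.Theory Num.Theory.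
Local Open Scope classical_set_scope.
Local Open Scope ring_scope.

(** A bijection of the request sequences of length n can only respect the bound
    if the dearest sequence for greedy costs at most rho times the dearest one
    for the optimum, up to the additive constant.

    Optimum: keep the servers at k equally spaced centers of covering radius
    about 1/(2k) and serve each request by a return trip from the nearest one, at
    a cost of about 1/k per request on every sequence.

    Greedy: it can first be forced to gather all its servers near the vertex 0.
    Two vertices a and b at mutual distance L, both further than L from the
    gathered servers, are then requested alternately, so that greedy shuttles a
    single server at a cost of L per request. One can take L close to 1/2 on the
    line and close to 1/3 on the circle. *)

(** * Comparison of growth rates *)

Lemma bounded_multiples_le0 (R : realType) (x B : R) (n1 : nat) :
  (forall n, (n1 <= n)%N -> n%:R * x <= B) -> x <= 0.
Proof.
move=> xB; rewrite leNgt; apply/negP => x0.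
have := xB (maxn n1 (Num.truncn (`|B| / x)).+1) (leq_maxl _ _).
rewrite leNgt => /negP; apply; rewrite -ltr_pdivrMr//.
apply: (le_lt_trans (y := `|B| / x)); first by rewrite ler_pM2r ?invr_gt0// ler_norm.
by apply: (lt_le_trans (truncnS_gt _)); rewrite ler_nat leq_maxr.
Qed.

(** [pi] sends a sequence dear for [a] to one on which [b] costs at most [c0 + beta * n]; letting
    [n] grow removes the additive constants. *)
Lemma asym_bij_ratio_le_growth (R : realType) (V : finType) (a b : seq V -> R)
    (alpha beta c0 rho : R) (N0 : nat) :
  0 < alpha ->
  (forall n, (N0 <= n)%N -> exists s : n.-tuple V, (n - N0)%:R * alpha <= a s) ->
  (forall s, 0 <= b s <= c0 + beta * (size s)%:R) ->
  asym_bij_ratio_le a b rho -> alpha <= rho * beta.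
Proof.
move=> alpha0 ha hb [c [n0 hpi]].
have key n : (maxn N0 n0 <= n)%N ->
    exists2 t : n.-tuple V, 0 <= b t <= c0 + beta * n%:R &
      n%:R * alpha - N0%:R * alpha <= rho * b t + c.
  rewrite geq_max => /andP[N0n /hpi[pi [_ hle]]].
  have [s hs] := ha n N0n; exists (pi s); first by rewrite -{3}(size_tuple (pi s)).
  by rewrite -mulrBl -natrB//; exact: le_trans (hle s).
have [rho0|rho0] := leP 0 rho.
- rewrite -subr_le0.
  apply: (@bounded_multiples_le0 _ _ (rho * c0 + c + N0%:R * alpha) (maxn N0 n0)).
  move=> n /key[t /andP[_ bt] ht].
  have := ler_wpM2l rho0 bt; nra.
(* For negative [rho] the right-hand side never exceeds [c], while the left-hand side grows like
   [n * alpha]. *)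
- suff : alpha <= 0 by rewrite leNgt alpha0.
  apply: (@bounded_multiples_le0 _ _ (c + N0%:R * alpha) (maxn N0 n0)).
  move=> n /key[t /andP[bt _] ht].
  have : rho * b t <= 0 by rewrite nmulr_rle0.
  lra.
Qed.

(** * Costs of schedules and an upper bound on the optimum *)

Section Costs.
Variables (R : realType) (V : finType) (d : V -> V -> R) (k : nat).
Hypothesis d_ge0 : forall x y, 0 <= d x y.

Lemma move_cost_ge0 (C C' : config V k) : 0 <= move_cost d C C'.
Proof. exact: sumr_ge0. Qed.

Lemma schedule_cost_ge0 (C : config V k) cs : 0 <= schedule_cost d C cs.
Proof. by elim: cs C => //= C' cs IH C; rewrite addr_ge0 ?move_cost_ge0. Qed.

Lemma schedule_cost_rcons (C C' : config V k) cs :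
  schedule_cost d C (rcons cs C') = schedule_cost d C cs + move_cost d (last C cs) C'.
Proof. by elim: cs C => [|D cs IH] C /=; rewrite ?addr0 ?add0r// IH addrA. Qed.

Lemma online_cost_rcons (A : online V k) s r :
  online_cost d A (rcons s r) = online_cost d A s + move_cost d (A s) (A (rcons s r)).
Proof.
rewrite /online_cost size_rcons -addn1 iotaD add0n map_cat /= cats1.
rewrite schedule_cost_rcons -(size_rcons s r) take_size.
have -> : [seq A (take t.+1 (rcons s r)) | t <- iota 0 (size s)] =
          [seq A (take t.+1 s) | t <- iota 0 (size s)].
  apply/eq_in_map => t; rewrite mem_iota add0n => /= ts.
  by rewrite -cats1 takel_cat.
congr (_ + move_cost d _ _).
case/lastP: s => // s x; rewrite size_rcons -addn1 iotaD map_cat /= last_cat /=.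
by rewrite add0n -(size_rcons s x) take_size.
Qed.

Lemma online_cost_ge0 (A : online V k) s : 0 <= online_cost d A s.
Proof. exact: schedule_cost_ge0. Qed.

Lemma move_cost_server_ge (C : config V k) i r :
  d (C i) r <= move_cost d C (move_server C i r).
Proof.
by rewrite /move_cost (bigD1 i)//= ffunE eqxx lerDl sumr_ge0.
Qed.

Lemma opt_ge0 (C : config V k) s : 0 <= opt d C s.
Proof.
rewrite /opt; set S := (X in inf X).
(* The infimum of the empty set is 0 by convention. *)
have [->|/set0P S0] := eqVneq S set0; first by rewrite inf0.
by apply: lb_le_inf => // _ [cs _ <-]; exact: schedule_cost_ge0.
Qed.

Section Centers.
Variables (d' : V -> V -> R) (Cc : config V k) (f : V -> 'I_k) (r : R).
Hypothesis d_le : forall x y, d x y <= d' x y.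
Hypothesis d'xx : forall x, d' x x = 0.
Hypothesis d'_sym : forall x y, d' x y = d' y x.
Hypothesis d'_triangle : forall x y z, d' x z <= d' x y + d' y z.
Hypothesis near_center : forall x, d' (Cc (f x)) x <= r.

Let excursion x := move_server Cc (f x) x.

Lemma move_cost_excursion x :
  move_cost d' Cc (excursion x) <= r /\ move_cost d' (excursion x) Cc <= r.
Proof.
have E : move_cost d' Cc (excursion x) <= r.
  rewrite /move_cost (bigD1 (f x))//= big1 => [|j /negPf jf].
    by rewrite ffunE eqxx addr0.
  by rewrite ffunE jf.
split=> //; apply: le_trans E.
by apply: ler_sum => j _; rewrite d'_sym.
Qed.

Lemma move_cost_via (C D E : config V k) :
  move_cost d C E <= move_cost d' C D + move_cost d' D E.
Proof.
by rewrite -big_split; apply: ler_sum => i _; apply: le_trans (d'_triangle _ _ _).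
Qed.

(** The return to the centers is merged with the next trip out: by the triangle inequality for [d'],
    a direct move costs at most the way back plus the way out. The term [move_cost d' C Cc] is the
    return still owed. *)
Lemma excursion_cost (C : config V k) s :
  schedule_cost d C (map excursion s) <= move_cost d' C Cc + 2 * r * (size s)%:R.
Proof.
elim: s C => [|x s IH] C /=.
  rewrite mulr0 addr0; apply: sumr_ge0 => i _; exact: le_trans (d_le _ _).
have := IH (excursion x); have := move_cost_via C Cc (excursion x).
have [] := move_cost_excursion x; rewrite -natr1; lra.
Qed.

Lemma opt_le_centers (C : config V k) s : opt d C s <= move_cost d' C Cc + 2 * r * (size s)%:R.
Proof.
apply: le_trans (excursion_cost C s); apply: ge_inf.
  by exists 0 => _ [cs _ <-]; exact: schedule_cost_ge0.
exists (map excursion s) => //=; rewrite /serves.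
elim: s => //= x s ->; rewrite andbT.
by apply/existsP; exists (f x); rewrite ffunE eqxx.
Qed.

End Centers.
End Costs.

(** * Forcing greedy to gather its servers and then to shuttle one *)

Section Greedy.
Variables (R : realType) (N k : nat) (d : 'I_N -> 'I_N -> R) (delta : R).
Hypothesis d_ge0 : forall x y, 0 <= d x y.
Hypothesis d_adjacent : forall x y : 'I_N, x = y.+1 :> nat -> d x y <= delta.
(** Restricted to interior [y], since on the cycle the vertices [0] and [N - 1] are adjacent. *)
Hypothesis d_close : forall x y : 'I_N,
  (0 < y)%N -> (y.+1 < N)%N -> d x y <= delta -> (x <= y.+1)%N /\ (y <= x.+1)%N.

(** Otherwise each occupied vertex above 1 has a server one or two steps below it, so the descent
    from [C i] never skips two consecutive vertices. Each of the [k + 1] disjoint pairs [2t, 2t+1]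
    with [t <= k] then holds a server, against the pigeonhole principle. *)
Lemma exists_double_gap (C : config 'I_N k) (i : 'I_k) : (k.*2 < C i)%N ->
  exists2 j : 'I_k, (1 < C j)%N &
    forall l : 'I_k, (C l).+1 <> C j :> nat /\ (C l).+2 <> C j :> nat.
Proof.
move=> Ci; apply: contrapT => nogap.
pose P v := exists l : 'I_k, C l = v :> nat.
have down v : (1 < v)%N -> P v -> P v.-1 \/ P v.-2.
  move=> v1 [j Cj]; apply: contrapT => /not_orP[n1 n2]; apply: nogap.
  exists j => [|l]; first by rewrite Cj.
  by rewrite Cj; split => E; [apply: n1|apply: n2]; exists l; rewrite -E.
have win t : (t < C i)%N -> P (C i - t)%N \/ P (C i - t).-1.
  elim: t => [_|t IH tC]; first by left; exists i; rewrite subn0.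
  rewrite subnS; case: (IH (ltnW tC)) => [/down|]; [|by left].
  by case; [lia|left|right].
have /choice[g gP] : forall t : 'I_k.+1, exists l : 'I_k, (C l)./2 = t.
  move=> t; have := win (C i - t.*2.+1)%N.
  rewrite subKn; last by have := ltn_ord t; lia.
  by case; [have := ltn_ord t; lia| |] => -[l El]; exists l; rewrite El; lia.
have inj : injective g by move=> s t gst; apply: val_inj; rewrite /= -!gP gst.
by have := leq_card g inj; rewrite !card_ord ltnn.
Qed.

Variables (C0 : config 'I_N k) (A : online 'I_N k).
Hypothesis greedyA : greedy d C0 A.

(* Requesting the vertex just below a server that has two free vertices beneath
   it forces, whatever the tie-breaking, that server to step down. *)
Lemma greedy_gather : exists s, forall i, (A s i <= k.*2)%N.
Proof.
(* The sum of the positions drops by one at each forced step, so the process ends. *)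
suff H n s : (\sum_(i < k) (A s i : nat) <= n)%N ->
    exists s, forall i, (A s i <= k.*2)%N by exact: (H _ [::] (leqnn _)).
elim: n s => [|n IH] s hn.
  by exists s => i; move: hn; rewrite (bigD1 i)//=; lia.
have [/existsP[i]|] := boolP [exists i, k.*2 < A s i]%N; last first.
  by rewrite negb_exists => /forallP H; exists s => i; rewrite leqNgt.
case/exists_double_gap => j j1 gap.
have qN : ((A s j).-1 < N)%N by have := ltn_ord (A s j); lia.
pose q := Ordinal qN.
have [i' [closest_i' Ai']] := greedyA.2 s q.
(* The chosen server is within [delta] of [q], hence at [q - 1], [q] or [q + 1]; the double gap
   excludes the first two. It may differ from [j] but stands on the same vertex. *)
have ji : A s i' = A s j :> nat.
  have adj : d (A s j) q <= delta by apply: d_adjacent; rewrite /= prednK// ltnW.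
  have q0 : (0 < q)%N by rewrite /= ltn_predRL.
  have q1 : (q.+1 < N)%N by rewrite /= prednK ?ltn_ord// ltnW.
  have [] := d_close q0 q1 (le_trans (closest_i' j) adj).
  by case: (gap i') => /=; move: j1; move: (nat_of_ord (A s i')) (nat_of_ord (A s j)); lia.
apply: (IH (rcons s q)); rewrite Ai'.
rewrite -ltnS; apply: leq_trans hn.
rewrite (bigD1 i')//= [ltnRHS](bigD1 i')//= ffunE eqxx /=.
under eq_bigr => l /negPf li do rewrite ffunE li.
by rewrite ltn_add2r ji ltn_predL ltnW.
Qed.

Variables (K : nat) (a b : 'I_N) (D : R).
Hypothesis K_ge : (k.*2 <= K)%N.
Hypotheses (d_ab : d a b = D) (d_ba : d b a = D).
Hypothesis d_far_a : forall x : 'I_N, (x <= K)%N -> D < d x a.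
Hypothesis d_far_b : forall x : 'I_N, (x <= K)%N -> D < d x b.

Let lonely (C : config 'I_N k) := exists i, (C i = a \/ C i = b) /\
  forall j, j != i -> (C j <= K)%N.

(** The endpoint not held by the lonely server is requested: it is at distance [D] from that server
    and strictly further from all others, so greedy has no choice. *)
Lemma greedy_lonely_step s : lonely (A s) -> exists r,
  lonely (A (rcons s r)) /\ D <= move_cost d (A s) (A (rcons s r)).
Proof.
move=> [i [Ci far]].
have [r [rab dr dfar]] : exists r, [/\ r = a \/ r = b, d (A s i) r = D &
    forall x : 'I_N, (x <= K)%N -> D < d x r].
  by case: Ci => ->; [exists b|exists a]; split=> //; [right|left].
have [j [closest_j Aj]] := greedyA.2 s r; exists r.
have ji : j = i.
  apply/eqP; apply: contraT => /far /dfar; rewrite ltNge -dr.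
  by rewrite closest_j.
rewrite Aj ji; split; last by rewrite -{1}dr; exact: move_cost_server_ge.
exists i; rewrite ffunE eqxx; split=> // l li.
by rewrite ffunE (negPf li) far.
Qed.

Lemma greedy_expensive : exists N0, forall n, (N0 <= n)%N ->
  exists s : n.-tuple 'I_N, (n - N0)%:R * D <= online_cost d A s.
Proof.
have [s0 near] := greedy_gather.
have [i [_ Ai]] := greedyA.2 s0 a.
have lonely0 : lonely (A (rcons s0 a)).
  exists i; rewrite Ai ffunE eqxx; split=> [|j ji]; first by left.
  by rewrite ffunE (negPf ji) (leq_trans (near j)).
pose s1 := rcons s0 a.
have ext t : exists s, [/\ size s = (size s1 + t)%N, lonely (A s) &
    t%:R * D <= online_cost d A s].
  elim: t => [|t [s [szs ls cs]]].
    by exists s1; rewrite addn0 mul0r online_cost_ge0.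
  have [r [lr cr]] := greedy_lonely_step ls; exists (rcons s r).
  rewrite size_rcons szs addnS online_cost_rcons; split=> //.
  by rewrite -natr1 mulrDl mul1r lerD.
(* The threshold counts the gathering requests and the first request of [a], whose cost is only
   bounded below by 0. *)
exists (size s1) => n sn; have [s [szs _ cs]] := ext (n - size s1)%N.
have szn : size s == n by rewrite szs subnKC.
by exists (Tuple szn).
Qed.

End Greedy.

(** * Both rates on a grid of spacing [1/m] *)

Lemma normB_nat (R : realDomainType) (x y : nat) :
  `|x%:R - y%:R| = ((x - y) + (y - x))%N%:R :> R.
Proof.
have [xy|/ltnW yx] := leqP x y.
  by rewrite distrC (eqP xy) add0n -natrB// normr_nat.
by rewrite (eqP yx) addn0 -natrB// normr_nat.
Qed.

(** The vertices are cut into [k] blocks of length [2h], enough since [2hk > m], with centers at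
    offset [h]. The line metric [d'] dominates the distances of the line and of the circle alike. *)
Lemma opt_le_grid (R : realType) (N m k : nat) (d : 'I_N -> 'I_N -> R)
    (C0 : config 'I_N k) :
  (0 < k)%N -> (0 < m)%N -> (N <= m.+1)%N ->
  (forall x y, 0 <= d x y <= `|(x : nat)%:R - (y : nat)%:R| / m%:R) ->
  exists c0 : R, forall s, 0 <= opt d C0 s <=
    c0 + 2 * ((m %/ k.*2).+1%:R / m%:R) * (size s)%:R.
Proof.
move=> k0 m0 Nm hd; set h := (m %/ k.*2).+1.
have N0 : (0 < N)%N by have := ltn_ord (C0 (Ordinal k0)); lia.
have mh : (m < h * k.*2)%N by rewrite ltn_ceil// double_gt0.
(* Capping a center at the last vertex only brings it closer to the other vertices. *)
have cN i : (minn (i.*2.+1 * h) N.-1 < N)%N by lia.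
pose Cc : config 'I_N k := [ffun i : 'I_k => Ordinal (cN i)].
have fk (x : 'I_N) : (x %/ h.*2 < k)%N.
  rewrite ltn_divLR ?double_gt0//; have := ltn_ord x; nia.
pose f x := Ordinal (fk x).
pose d' (x y : 'I_N) : R := `|(x : nat)%:R - (y : nat)%:R| / m%:R.
have mV0 : 0 <= (m%:R : R)^-1 by rewrite invr_ge0.
have near x : d' (Cc (f x)) x <= h%:R / m%:R.
  rewrite /d' ffunE /= normB_nat ler_wpM2r// ler_nat.
  have := divn_eq x h.*2; have : (x %% h.*2 < h.*2)%N by rewrite ltn_pmod ?double_gt0.
  have := ltn_ord x; set q := (x %/ _)%N; set r := (x %% _)%N.
  have -> : (q.*2.+1 * h = q * h.*2 + h)%N by nia.
  lia.
have d_ge0 x y : 0 <= d x y by case/andP: (hd x y).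
have d_le x y : d x y <= d' x y by case/andP: (hd x y).
exists (move_cost d' C0 Cc) => s; apply/andP; split.
  exact: opt_ge0.
apply: (opt_le_centers d_ge0 d_le) near _ _.
- by move=> x; rewrite /d' subrr normr0 mul0r.
- by move=> x y; rewrite /d' distrC.
- by move=> x y z; rewrite /d' -mulrDl ler_wpM2r// ler_distD.
Qed.

Lemma greedy_ratio_growth (R : realType) (N m k L : nat) (d : 'I_N -> 'I_N -> R)
    (C0 : config 'I_N k) (A : online 'I_N k) (a b : 'I_N) (rho : R) :
  (0 < k)%N -> (0 < m)%N -> (N <= m.+1)%N -> (0 < L)%N ->
  (forall x y, 0 <= d x y <= `|(x : nat)%:R - (y : nat)%:R| / m%:R) ->
  (forall x y : 'I_N, (0 < y)%N -> (y.+1 < N)%N -> d x y <= m%:R^-1 ->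
     (x <= y.+1)%N /\ (y <= x.+1)%N) ->
  d a b = L%:R / m%:R -> d b a = L%:R / m%:R ->
  (forall x : 'I_N, (x <= k.*2)%N -> L%:R / m%:R < d x a) ->
  (forall x : 'I_N, (x <= k.*2)%N -> L%:R / m%:R < d x b) ->
  greedy d C0 A ->
  asym_bij_ratio_le (online_cost d A) (opt d C0) rho ->
  L%:R <= rho * (2 * (m %/ k.*2).+1%:R).
Proof.
move=> k0 m0 Nm L0 hd close dab dba fara farb greedyA hrho.
have m0R : 0 < m%:R :> R by rewrite ltr0n.
have d_ge0 x y : 0 <= d x y by case/andP: (hd x y).
have adj (x y : 'I_N) : x = y.+1 :> nat -> d x y <= m%:R^-1.
  move=> xy; case/andP: (hd x y) => _ /le_trans; apply.
  by rewrite normB_nat xy subSnn (eqP (leqnSn _)) addn0 mul1r.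
have [N0 hN0] := greedy_expensive d_ge0 adj close greedyA (leqnn _)
                   dab dba fara farb.
have [c0 hc0] := opt_le_grid C0 k0 m0 Nm hd.
have := asym_bij_ratio_le_growth (divr_gt0 _ m0R) hN0 hc0 hrho.
by rewrite ltr0n L0 => /(_ isT); rewrite !mulrA ler_pM2r ?invr_gt0.
Qed.

(** Here [L] is about [m/p] and [2h] about [m/k], so [L/(2h)] is about [k/p]. Rounding loses
    [2k + 4] through [L] and [2k] through [h]; after multiplication by [k], both are absorbed by
    [eps * m]. *)
Lemma ratio_ge_of_growth (R : realType) (k m p L : nat) (eps rho : R) :
  (0 < k)%N -> (0 < p)%N -> 0 < eps ->
  (m <= p * L + (k.*2 + 4))%N ->
  (k * (k.*2 + 4 + k.*2))%:R <= eps * m%:R ->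
  L%:R <= rho * (2 * (m %/ k.*2).+1%:R) ->
  k%:R / p%:R - eps <= rho.
Proof.
move=> k0 p0 eps0 mL meps hL; set h := (m %/ k.*2).+1 in hL.
have hm : (h * k.*2 <= m + k.*2)%N by rewrite mulSn addnC leq_add2r leq_divM.
have k0R : 0 < k%:R :> R by rewrite ltr0n.
have p1R : 1 <= p%:R :> R by rewrite ler1n.
have p0R : 0 < p%:R :> R by rewrite ltr0n.
have rho0 : 0 <= rho.
  rewrite -(@pmulr_lge0 _ (2 * h%:R)); last by rewrite mulr_gt0// ltr0n.
  exact: le_trans hL.
have step : k%:R * L%:R <= rho * (m%:R + 2 * k%:R).
  apply: (le_trans (y := k%:R * (rho * (2 * h%:R)))); first by rewrite ler_pM2l.
  rewrite mulrCA ler_wpM2l// -!natrM -natrD ler_nat; lia.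
have mL' : m%:R <= p%:R * L%:R + (2 * k%:R + 4) :> R.
  by rewrite -!natrM -!natrD ler_nat mul2n.
have meps' : k%:R * (4 * k%:R + 4) <= eps * m%:R.
  apply: le_trans meps; rewrite -!natrM -!natrD -natrM ler_nat; nia.
rewrite lerBlDr ler_pdivrMr// -(@ler_pM2r _ (m%:R + 2 * k%:R)); last first.
  by rewrite ltr_wpDl// mulr_gt0.
have : k%:R * m%:R <= k%:R * (p%:R * L%:R + (2 * k%:R + 4)) :> R by rewrite ler_pM2l.
have : p%:R * (k%:R * L%:R) <= p%:R * (rho * (m%:R + 2 * k%:R)) by rewrite ler_pM2l.
have : eps * m%:R <= p%:R * (eps * m%:R) by rewrite ler_peMl// mulr_ge0// ltW.
have : 0 <= p%:R * (eps * k%:R) by rewrite !mulr_ge0// ltW.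
lra.
Qed.

(** A strict bound is an asymptotic one with [c = 0], so the asymptotic case settles both. *)
Lemma asym_bij_ratio_ge (R : realType) (V : finType) (a b : seq V -> R) (x : R) :
  (forall rho, asym_bij_ratio_le a b rho -> x <= rho) ->
  (x%:E <= bij_ratio a b)%E /\ (x%:E <= asym_bij_ratio a b)%E.
Proof.
move=> H; split; apply: le_ereal_inf_tmp => _ [rho hrho <-]; rewrite lee_fin; apply: H => //.
case: hrho => n0 hn0; exists 0, n0 => n /hn0[pi [bpi hpi]].
by exists pi; split=> // s; rewrite addr0.
Qed.

(** * Choice of the two vertices on the line and on the circle *)

Theorem theorem7 (R : realType) (k : nat) (hk : (0 < k)%N)
    (eps : R) (heps : 0 < eps) :
  (exists2 m0 : nat, (0 < m0)%N &
     forall m : nat, (m0 <= m)%N ->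
     forall (C0 : config 'I_m.+1 k) (A : online 'I_m.+1 k),
       greedy (@line_dist R m) C0 A ->
       ((k%:R / 2 - eps)%:E <=
          bij_ratio (online_cost (@line_dist R m) A)
                    (opt (@line_dist R m) C0))%E /\
       ((k%:R / 2 - eps)%:E <=
          asym_bij_ratio (online_cost (@line_dist R m) A)
                         (opt (@line_dist R m) C0))%E) /\
  (exists2 m0 : nat, (0 < m0)%N &
     forall m : nat, (m0 <= m)%N ->
     forall (C0 : config 'I_m k) (A : online 'I_m k),
       greedy (@circle_dist R m) C0 A ->
       ((k%:R / 3 - eps)%:E <=
          bij_ratio (online_cost (@circle_dist R m) A)
                    (opt (@circle_dist R m) C0))%E /\
       ((k%:R / 3 - eps)%:E <=
          asym_bij_ratio (online_cost (@circle_dist R m) A)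
                         (opt (@circle_dist R m) C0))%E).
Proof.
(* [B] is the total rounding error to be absorbed; the summand [2k + 8] in [m0] keeps [L] positive
   below. *)
pose B : R := (k * (k.*2 + 4 + k.*2))%:R.
pose m0 := (k.*2 + 8 + (Num.truncn (B / eps)).+1)%N.
have m0P m : (m0 <= m)%N -> B <= eps * m%:R.
  move=> m0m; rewrite mulrC -ler_pdivrMr//; apply: (le_trans (ltW (truncnS_gt _))).
  by rewrite ler_nat; apply: leq_trans m0m; rewrite leq_addl.
have m0_gt0 : (0 < m0)%N by rewrite /m0; lia.
split; exists m0 => // m m0m C0 A greedyA; apply: asym_bij_ratio_ge => rho hrho.
- have m8 : (k.*2 + 8 <= m)%N by lia.
  (* With [a = 2k + L + 1] and [b = a + L <= m], the extra 1 makes the distance from [[0, 2k]] to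
     [a] exceed [L] strictly. *)
  pose L := ((m - k.*2 - 1) %/ 2)%N.
  have aN : (k.*2 + L + 1 < m.+1)%N by rewrite /L; lia.
  have bN : (k.*2 + L.*2 + 1 < m.+1)%N by rewrite /L; lia.
  have mR : 0 < m%:R^-1 :> R by rewrite invr_gt0 ltr0n; lia.
  apply: (@ratio_ge_of_growth R k m 2 L) => //; [rewrite /L; lia|exact: m0P|].
  apply: (greedy_ratio_growth (a := Ordinal aN) (b := Ordinal bN)) greedyA hrho => //.
  + lia.
  + by rewrite /L; lia.
  + by move=> x y; rewrite /line_dist lexx mulr_ge0// ltW.
  + move=> x y _ _; rewrite /line_dist -[leRHS]mul1r ler_pM2r//.
    by rewrite normB_nat lern1; lia.
  + by rewrite /line_dist normB_nat /=; congr (_%:R / _); lia.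
  + by rewrite /line_dist normB_nat /=; congr (_%:R / _); lia.
  + by move=> x xK; rewrite /line_dist normB_nat ltr_pM2r// ltr_nat /=; lia.
  + by move=> x xK; rewrite /line_dist normB_nat ltr_pM2r// ltr_nat /=; lia.
- have m8 : (k.*2 + 8 <= m)%N by lia.
  (* A third arc is needed: from [b] onwards round to [0] there remain at least [L + 1] edges, so
     the gathered servers are far from [b] on that side too. *)
  pose L := ((m - k.*2 - 2) %/ 3)%N.
  have aN : (k.*2 + L + 1 < m)%N by rewrite /L; lia.
  have bN : (k.*2 + L.*2 + 1 < m)%N by rewrite /L; lia.
  have LN : (k.*2 + 3 * L + 1 < m)%N by rewrite /L; lia.
  have mR : 0 < m%:R^-1 :> R by rewrite invr_gt0 ltr0n; lia.
  have circE (x y : 'I_m) : circle_dist R x y =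
      Num.min ((x - y) + (y - x))%N%:R (m - ((x - y) + (y - x)))%N%:R / m%:R.
    rewrite /circle_dist normB_nat -natrB//.
    by have := ltn_ord x; have := ltn_ord y; lia.
  apply: (@ratio_ge_of_growth R k m 3 L) => //; [rewrite /L; lia|exact: m0P|].
  apply: (greedy_ratio_growth (a := Ordinal aN) (b := Ordinal bN)) greedyA hrho => //.
  + lia.
  + by rewrite /L; lia.
  + move=> x y; rewrite normB_nat circE ler_pM2r// ge_min lexx andbT.
    by rewrite mulr_ge0 ?(ltW mR)// le_min !ler0n.
  + move=> x y y0 ym; rewrite circE -[leRHS]mul1r ler_pM2r// ge_min !lern1.
    by have := ltn_ord x; lia.
  + rewrite circE min_l /=; first by congr (_%:R / _); lia.
    by rewrite ler_nat; lia.
  + rewrite circE min_l /=; first by congr (_%:R / _); lia.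
    by rewrite ler_nat; lia.
  + by move=> x xK; rewrite circE ltr_pM2r// lt_min !ltr_nat /=; lia.
  + by move=> x xK; rewrite circE ltr_pM2r// lt_min !ltr_nat /=; lia.
Qed.
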